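(* For all integers $n,s\ge 1$, $\chi_{ltna}(C_{4n+2}\vee O_{2s+1})=3$.
   Context: All graphs are finite and simple. $C_k$ is the cycle on $k$ vertices. $O_m$ is the null (edgeless) graph on $m$ vertices. The join $G\vee H$ of (vertex-disjoint) graphs has $V(G\vee H)=V(G)\cup V(H)$ and $E(G\vee H)=E(G)\cup E(H)\cup\{uv\mid u\in V(G),v\in V(H)\}$. For a graph $G=(V,E)$ of order $p$ and size $q$ without isolated vertices, a bijection $f:V\cup E\to\{1,\dots,p+q\}$ is a local total neighborhood antimagic labeling of $G$ if the induced vertex coloring $f^+_{tn}(u)=\sum_{ux\in E}[f(ux)+f(x)]$ satisfies $f^+_{tn}(u)\ne f^+_{tn}(v)$ for every edge $uv\in E$. The number of distinct induced colors is $c_{tn}(f)$. The local total neighborhood antimagic chromatic number $\chi_{ltna}(G)$ is the minimum of $c_{tn}(f)$ over all local total neighborhood antimagic labelings $f$ of $G$; an assertion $\chi_{ltna}(G)=k$ includes the assertion that $G$ admits such a labeling. *)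

(* Defs.v *)
From mathcomp Require Import all_boot.

Set Implicit Arguments.
Unset Strict Implicit.
Unset Printing Implicit Defensive.

Record sgraph := SGraph {
  vertex :> finType;
  adj : rel vertex;
  adj_sym : symmetric adj;
  adj_irr : irreflexive adj
}.

Definition edges (G : sgraph) : {set {set G}} :=
  [set [set p.1; p.2] | p : G * G & adj p.1 p.2].

Definition gorder (G : sgraph) : nat := #|G|.
Definition gsize (G : sgraph) : nat := #|edges G|.

Definition no_isolated (G : sgraph) : Prop :=
  forall u : G, exists v : G, adj u v.

(* [ordS] is the successor modulo k.  This is the cycle C_k only for k >= 3;
   the condition i != j matters only for k = 1. *)
Definition cycle_adj (k : nat) : rel 'I_k :=
  fun i j => (i != j) && ((j == ordS i) || (i == ordS j)).

Fact cycle_adj_sym k : symmetric (@cycle_adj k).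
Proof. by move=> i j; rewrite /cycle_adj eq_sym orbC. Qed.

Fact cycle_adj_irr k : irreflexive (@cycle_adj k).
Proof. by move=> i; rewrite /cycle_adj eqxx. Qed.

Definition cycle_graph (k : nat) : sgraph :=
  SGraph (@cycle_adj_sym k) (@cycle_adj_irr k).

Definition null_adj (m : nat) : rel 'I_m := fun _ _ => false.

Fact null_adj_sym m : symmetric (@null_adj m).
Proof. by []. Qed.

Fact null_adj_irr m : irreflexive (@null_adj m).
Proof. by []. Qed.

Definition null_graph (m : nat) : sgraph :=
  SGraph (@null_adj_sym m) (@null_adj_irr m).

Definition join_adj (G H : sgraph) : rel (G + H)%type :=
  fun a b => match a, b with
  | inl u, inl v => adj u v
  | inr u, inr v => adj u v
  | _, _ => true
  end.

Fact join_adj_sym G H : symmetric (@join_adj G H).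
Proof. by case=> [u|u] [v|v] //=; apply: adj_sym. Qed.

Fact join_adj_irr G H : irreflexive (@join_adj G H).
Proof. by case=> u /=; apply: adj_irr. Qed.

Definition graph_join (G H : sgraph) : sgraph :=
  SGraph (@join_adj_sym G H) (@join_adj_irr G H).

(* A labeling of V \cup E is a total function on V + {set V} of which only the
   values on [elements G], the disjoint union of V and E, are ever used. *)
Definition elements (G : sgraph) : {set G + {set G}} :=
  [set z | match z with inl _ => true | inr e => e \in edges G end].

Definition total_labeling (G : sgraph) (f : G + {set G} -> nat) : Prop :=
  {in elements G &, injective f} /\
  (forall k : nat, 1 <= k <= gorder G + gsize G <->
     exists2 z, z \in elements G & f z = k).

Definition tn_color (G : sgraph) (f : G + {set G} -> nat) (u : G) : nat :=
  \sum_(x : G | adj u x) (f (inr [set u; x]) + f (inl x)).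

Definition ltna_labeling (G : sgraph) (f : G + {set G} -> nat) : Prop :=
  total_labeling f /\
  (forall u v : G, adj u v -> tn_color f u <> tn_color f v).

Definition c_tn (G : sgraph) (f : G + {set G} -> nat) : nat :=
  size (undup [seq tn_color f u | u : G]).

(* chi_ltna(G) = k, as a relation because a graph might admit no such
   labeling. *)
Definition is_chi_ltna (G : sgraph) (k : nat) : Prop :=
  [/\ no_isolated G,
      exists f : G + {set G} -> nat, ltna_labeling f /\ c_tn f = k
    & forall f : G + {set G} -> nat, ltna_labeling f -> k <= c_tn f].

(* Main.v *)
Require Import Defs.
From mathcomp Require Import all_boot.
From mathcomp Require Import zify.

Set Implicit Arguments.
Unset Strict Implicit.
Unset Printing Implicit Defensive.

(** Write [h = 2n+1], so that the cycle has [2h] vertices, and [m = 2s+1].  The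
    [2h(m+2)] labels other than those of the null graph are arranged in [m+2]
    blocks of [2h]: the cycle vertices, the cycle edges, and the [m] columns of
    the join edges.  In each block the labels at positions [i] and [i+h] add up
    to a constant [T], because they lie symmetrically around [T/2]
    and [h] is odd, so that the parity of [i] can select the side.  Hence all
    vertices of the null graph have colour [2hT], and the colours of the cycle
    vertices at [i] and [i+h] are exchanged by antipodal_sum.  It then suffices
    that the colour is constant at even [i]: the distances from [T/2] in
    the first three blocks, [i/4], [i] and [i/2] modulo [h] up to shifts, are
    chosen so that their wrap-arounds cancel, and the other columns cancel in
    pairs.  The lower bound comes from a triangle. *)

(** * Residues *)

Lemma modn_lt_double (d x : nat) : x < 2 * d ->
  x %% d = if x < d then x else x - d.
Proof.
move=> lt_x2d; case: ltnP => [/modn_small // | le_dx].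
by rewrite -{1}(subnK le_dx) modnDr modn_small //; lia.
Qed.

Lemma eqn_modMl (d p m n : nat) : coprime d p ->
  (p * m == p * n %[mod d]) = (m == n %[mod d]).
Proof.
move=> cop; wlog le_nm : m n / n <= m => [hwlog|].
  by have [|/ltnW] := leqP n m; last rewrite eq_sym [RHS]eq_sym; apply: hwlog.
by rewrite !eqn_mod_dvd ?leq_mul2l ?le_nm ?orbT // -mulnBr Gauss_dvdr.
Qed.

(** * Labelings of an arbitrary graph *)

Lemma card_elements (G : sgraph) : #|elements G| = gorder G + gsize G.
Proof.
rewrite -sum1_card big_mkcond big_sumType /= /gorder /gsize -!sum1_card.
congr (_ + _); first by apply: eq_bigr => x _; rewrite inE.
by rewrite [RHS]big_mkcond; apply: eq_bigr => e _; rewrite inE.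
Qed.

(** Surjectivity is free: an injective labeling of [K] with values from 1 to [#|K|] hits each of
    them. So a labeling can be given on any type [K] that indexes vertices and edges once each. *)
Lemma total_labeling_transport (G : sgraph) (K : finType)
    (el : K -> G + {set G}) (lab : K -> nat) :
    injective el -> el @: setT = elements G ->
    injective lab -> (forall x, 1 <= lab x <= #|K|) ->
  exists f : G + {set G} -> nat, total_labeling f /\ forall x, f (el x) = lab x.
Proof.
move=> el_inj el_im lab_inj lab_bound.
pose f z := if [pick x | el x == z] is Some x then lab x else 0.
have fE x : f (el x) = lab x.
  rewrite /f; case: pickP => [y /eqP /el_inj -> // | /(_ x)]; by rewrite eqxx.
have elP z : z \in elements G -> exists x, z = el x.
  by rewrite -el_im => /imsetP[x _ ->]; exists x.
have cardK : gorder G + gsize G = #|K|.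
  by rewrite -card_elements -el_im card_imset // cardsT.
exists f; split=> //; split=> [_ _ /elP[x ->] /elP[y ->] | l].
  by rewrite !fE => /lab_inj ->.
rewrite cardK; split=> [l_bound | [_ /elP[x ->]] <-]; last by rewrite fE.
have lt_lab x : (lab x).-1 < #|K| by have := lab_bound x; lia.
pose g x := Ordinal (lt_lab x).
have g_inj : injective g.
  move=> x y /(congr1 val) /= eq_xy; apply: lab_inj.
  by have := lab_bound x; have := lab_bound y; lia.
have lt_l : l.-1 < #|K| by lia.
have /imsetP[x _ /(congr1 val) /= def_l] : Ordinal lt_l \in g @: setT.
  have /eqP -> : g @: setT == setT.
    by rewrite eqEcard subsetT card_imset // !cardsT card_ord leqnn.
  by rewrite inE.
exists (el x); first by rewrite -el_im imset_f.
by rewrite fE; have := lab_bound x; lia.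
Qed.

Lemma triangle_leq_c_tn (G : sgraph) (f : G + {set G} -> nat) (u v w : G) :
  ltna_labeling f -> adj u v -> adj v w -> adj u w -> 3 <= c_tn f.
Proof.
move=> [_ proper] uv vw uw.
apply: (@uniq_leq_size _ [:: tn_color f u; tn_color f v; tn_color f w]) => [|c].
  rewrite /= !inE negb_or !andbT -andbA.
  by apply/and3P; split; apply/eqP; apply: proper.
rewrite mem_undup !inE => /or3P[] /eqP ->; exact: image_f.
Qed.

(** * Neighbours on a cycle, and a sum in pairs *)

Lemma neq_ordS (k : nat) (i : 'I_k) : 1 < k -> i != ordS i.
Proof.
move=> k_gt1; have lt_ik := ltn_ord i; apply/eqP => /(congr1 val) /=.
have [e|ne] := eqVneq i.+1 (k : nat); first by rewrite e modnn; lia.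
by rewrite modn_small; lia.
Qed.

Lemma neq_ordSS (k : nat) (i : 'I_k) : 2 < k -> i != ordS (ordS i).
Proof.
move=> k_gt2; have lt_ik := ltn_ord i; apply/eqP => /(congr1 val) /=.
have [e|ne] := eqVneq i.+1 (k : nat); first by rewrite e modnn modn_small; lia.
rewrite (@modn_small i.+1); last by lia.
have [e|ne'] := eqVneq i.+2 (k : nat); first by rewrite e modnn; lia.
by rewrite modn_small; lia.
Qed.

Lemma sum_cycle_adj (k : nat) (i : 'I_k) (F : 'I_k -> nat) : 2 < k ->
  \sum_(j | cycle_adj i j) F j = F (ordS i) + F (ord_pred i).
Proof.
move=> k_gt2.
have neS : ordS i != i by rewrite eq_sym neq_ordS // ltnW.
have neP : ord_pred i != i by rewrite -(can_eq (@ordSK k)) ord_predK neq_ordS // ltnW.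
have neSP : ord_pred i != ordS i.
  by rewrite -(can_eq (@ordSK k)) ord_predK neq_ordSS.
have adjE j : cycle_adj i j = (j == ordS i) || (j == ord_pred i).
  rewrite /cycle_adj -(can2_eq (@ord_predK k) (@ordSK k) i j) (eq_sym (ord_pred i)).
  by have [<-|] := eqVneq i j; rewrite // !(eq_sym i) (negPf neS) (negPf neP).
rewrite (eq_bigl _ _ adjE) (bigD1 (ordS i)) ?eqxx //=; congr (_ + _).
rewrite (big_pred1 (ord_pred i)) // => j /=.
by case: eqVneq => [-> | _] /=; rewrite ?andbT // eq_sym (negPf neSP).
Qed.

Lemma sum_ord_pairs (s c : nat) (F : nat -> nat) :
  (forall r, r < s -> F r.*2 + F r.*2.+1 = c) ->
  \sum_(j < s.*2) F j = s * c.
Proof.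
elim: s => [|s IHs] Fc; first by rewrite big_ord0.
rewrite doubleS !big_ord_recr /= IHs => [|r lt_rs]; last by apply: Fc; lia.
by have := Fc s (ltnSn s); lia.
Qed.

(** * The labels and their distinctness *)

(* Block [0] is the cycle vertices, block [1] the edges [{i, i+1}], block [j + 2]
   the edges to the vertex [j] of the null graph.  Modulo [2n+1], the factor
   [n+1] is division by 2. *)
Definition offset (n b i : nat) : nat :=
  match b with
  | 0 => n.+1 ^ 2 * i
  | 2 => n.+1 * (i + 3)
  | _ => i + 3
  end %% (2 * n + 1).

Definition half_count (n s : nat) : nat := (2 * s + 3) * (2 * n + 1).

(** The blocks use the labels from [s + 1] to [s + 2 * half_count n s], centred at T/2; the distance
    from T/2 is [d + 1/2]. As [b] enters the parity, adjacent blocks lie on opposite sides at each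
    [i]. *)
Definition row_label (n s b i : nat) : nat :=
  let d := b * (2 * n + 1) + offset n b i in
  if odd (i + b) then s + half_count n s - d else s + half_count n s + 1 + d.

(* The lowest [s] and the highest [s + 1] labels. *)
Definition null_label (n s j : nat) : nat :=
  j.+1 + (if s <= j then 2 * half_count n s else 0).

(** This is T; it is also the order plus the size of the join, hence the largest label. *)
Definition antipodal_sum (n s : nat) : nat := 2 * half_count n s + 2 * s + 1.

Lemma offset_lt n b i : offset n b i < 2 * n + 1.
Proof. by rewrite ltn_mod; lia. Qed.

Lemma offset_congr n b i j :
  i = j %[mod 2 * n + 1] -> offset n b i = offset n b j.
Proof.
move=> eq_ij; case: b => [|[|[|b]]]; rewrite /offset.
- by rewrite -modnMmr eq_ij modnMmr.
- by rewrite -modnDml eq_ij modnDml.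
- by rewrite -modnMmr -modnDml eq_ij modnDml modnMmr.
- by rewrite -modnDml eq_ij modnDml.
Qed.

(** The period is even and a multiple of [2 * n + 1], so it preserves side and offset. Positions may
    thus run past the end of the cycle. *)
Lemma row_label_congr n s b i j :
  i = j %[mod 4 * n + 2] -> row_label n s b i = row_label n s b j.
Proof.
move=> eq_ij; rewrite /row_label.
have -> : offset n b i = offset n b j.
  by apply: offset_congr; rewrite -(@modn_dvdm (4 * n + 2)) ?eq_ij ?modn_dvdm //;
     apply/dvdnP; exists 2; lia.
have -> // : odd (i + b) = odd (j + b).
rewrite !oddD; congr (_ (+) _).
have even_k : ~~ odd (4 * n + 2) by lia.
have := congr1 odd eq_ij.
rewrite (divn_eq i (4 * n + 2)) (divn_eq j (4 * n + 2)).
by rewrite !modnMDl !modn_mod !oddD !oddM (negPf even_k) !andbF.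
Qed.

Lemma row_depth_lt n s b i : b < 2 * s + 3 ->
  b * (2 * n + 1) + offset n b i < half_count n s.
Proof. by move=> lt_b; have := offset_lt n b i; rewrite /half_count; nia. Qed.

Lemma offset_inj n b i j : offset n b i = offset n b j -> i = j %[mod 2 * n + 1].
Proof.
have cop : coprime (2 * n + 1) n.+1.
  rewrite (_ : 2 * n + 1 = n.+1 + n); last by lia.
  by rewrite coprime_sym /coprime gcdnDl [_ == _]coprimeSn.
case: b => [|[|[|b]]]; rewrite /offset => /eqP.
- by rewrite eqn_modMl ?coprimeXr // => /eqP.
- by rewrite eqn_modDr => /eqP.
- by rewrite eqn_modMl // eqn_modDr => /eqP.
- by rewrite eqn_modDr => /eqP.
Qed.

Lemma row_label_inj n s b c i j :
    b < 2 * s + 3 -> c < 2 * s + 3 -> i < 4 * n + 2 -> j < 4 * n + 2 ->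
  row_label n s b i = row_label n s c j -> b = c /\ i = j.
Proof.
move=> lt_b lt_c lt_i lt_j.
have db := row_depth_lt n i lt_b; have dc := row_depth_lt n j lt_c.
rewrite /row_label => eq_lab.
have [eq_odd eq_d] : odd (i + b) = odd (j + c) /\
   b * (2 * n + 1) + offset n b i = c * (2 * n + 1) + offset n c j.
  by move: eq_lab; case: odd; case: odd; lia.
have h_gt0 : 0 < 2 * n + 1 by lia.
have eq_bc : b = c.
  by have := congr1 (divn^~ (2 * n + 1)) eq_d;
     rewrite !divnMDl // !divn_small ?offset_lt // !addn0.
subst c; split=> //.
have eq_off : offset n b i = offset n b j by lia.
(* The position is known modulo the odd number [2 * n + 1], and its parity by [eq_odd]; this fixes
   it below [4 * n + 2]. *)
have := offset_inj eq_off.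
rewrite !modn_lt_double; try lia.
by do 2!case: ifP; lia.
Qed.

Lemma row_label_bound n s b i : b < 2 * s + 3 ->
  s < row_label n s b i <= s + 2 * half_count n s.
Proof.
by move=> /(row_depth_lt n i); rewrite /row_label; case: odd; lia.
Qed.

(** * Sums of labels *)

Lemma row_label_antipodal n s b i : b < 2 * s + 3 ->
  row_label n s b i + row_label n s b (i + (2 * n + 1)) = antipodal_sum n s.
Proof.
move=> lt_b; have := row_depth_lt n i lt_b; rewrite /row_label /antipodal_sum.
rewrite (@offset_congr n b (i + (2 * n + 1)) i) ?modnDr //.
rewrite (_ : odd (i + (2 * n + 1) + b) = ~~ odd (i + b)); last by lia.
by case: odd => /=; lia.
Qed.

(* With [a], [x] the offsets of [i.+2] in block 0 and of [i.+1] in block 2, one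
   has [x = 2a + 1], and the edge offsets wrap around exactly when [x = 0]. *)
Lemma offset_balance n i :
  offset n 1 i + offset n 2 i.+1 + n =
  offset n 0 i.+2 + offset n 0 i + offset n 1 i.+1.
Proof.
have lt_h x : x %% (2 * n + 1) < 2 * n + 1 by rewrite ltn_mod; lia.
rewrite /offset.
set a := (n.+1 ^ 2 * i.+2) %% _; set b := (n.+1 ^ 2 * i) %% _.
set x := (n.+1 * (i.+1 + 3)) %% _; set w := (i.+1 + 3) %% _; set v := (i + 3) %% _.
have [la lb lx lw lv] : [/\ a < 2 * n + 1, b < 2 * n + 1, x < 2 * n + 1,
    w < 2 * n + 1 & v < 2 * n + 1].
  by rewrite !lt_h.
have Ex : x = (2 * a + 1) %% (2 * n + 1).
  rewrite /a -modnDml modnMmr modnDml.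
  rewrite -modnDl (_ : _ + _ = n.+1 * i.+2 * (2 * n + 1) + n.+1 * (i.+1 + 3)).
    by rewrite modnMDl.
  by rewrite -mulnn; lia.
have Ea : a = (b + (n + 1)) %% (2 * n + 1).
  rewrite /a /b modnDml (_ : n.+1 ^ 2 * i.+2 =
    n.+1 * (2 * n + 1) + (n.+1 ^ 2 * i + (n + 1))).
    by rewrite modnMDl.
  by rewrite -mulnn; lia.
have Ew : w = (2 * x) %% (2 * n + 1).
  rewrite /x modnMmr (_ : 2 * (n.+1 * (i.+1 + 3)) =
    (i.+1 + 3) * (2 * n + 1) + (i.+1 + 3)); last by lia.
  by rewrite modnMDl.
have Ewv : w = (v + 1) %% (2 * n + 1) by rewrite /v modnDml; congr (_ %% _); lia.
(* Here [b = a + n] if [a <= n], and [b = a - n.+1] otherwise. The wrap-around [x = w = 0],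
   [v = 2 * n] is the case [a = n]. *)
clearbody a b x w v; move: Ex Ea Ew Ewv.
rewrite !modn_lt_double; try lia.
by do 4!case: ifP; lia.
Qed.

(** The two columns have equal offsets and opposite sides, so only the difference [2 * n + 1] of
    their depths survives. *)
Lemma row_label_pair n s r i : r < s ->
  row_label n s (3 + r.*2) i + row_label n s (4 + r.*2) i =
  if odd i then antipodal_sum n s - (2 * n + 1) else antipodal_sum n s + (2 * n + 1).
Proof.
move=> lt_rs.
have lt3 : 3 + r.*2 < 2 * s + 3 by lia.
have lt4 : 4 + r.*2 < 2 * s + 3 by lia.
have := row_depth_lt n i lt3; have := row_depth_lt n i lt4.
rewrite /row_label (_ : odd (i + (3 + r.*2)) = ~~ odd i); last by lia.
rewrite (_ : odd (i + (4 + r.*2)) = odd i); last by lia.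
have -> : offset n (4 + r.*2) i = offset n (3 + r.*2) i by [].
have -> : (4 + r.*2) * (2 * n + 1) = (3 + r.*2) * (2 * n + 1) + (2 * n + 1) by lia.
by rewrite /antipodal_sum; case: odd => /=; lia.
Qed.

Lemma sum_row_label n s i :
  \sum_(j < 2 * s + 1) row_label n s (j + 2) i = row_label n s 2 i +
  s * (if odd i then antipodal_sum n s - (2 * n + 1)
       else antipodal_sum n s + (2 * n + 1)).
Proof.
rewrite addn1 mul2n big_ord_recl; congr (_ + _).
rewrite -(@sum_ord_pairs s _ (fun j => row_label n s (3 + j) i)) => [|r lt_rs].
  by apply: eq_bigr => j _; rewrite lift0 addnC.
by rewrite addnS row_label_pair.
Qed.

(** Each low label [l] pairs with the high label [T - l], and T itself is left over. *)
Lemma sum_null_label n s :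
  \sum_(j < 2 * s + 1) null_label n s j = s.+1 * antipodal_sum n s.
Proof.
(* Truncated [t - s] counts the high labels among the first [t]. *)
have sumE t : 2 * (\sum_(j < t) null_label n s j) =
    t * t.+1 + (t - s) * (4 * half_count n s).
  elim: t => [|t IHt]; first by rewrite big_ord0.
  rewrite big_ord_recr mulnDr IHt /null_label /=.
  case: leqP => [le_st | lt_ts].
    by rewrite subSn // (mulSn (t - s)); move: (_ * (4 * _)) => w; lia.
  by rewrite (eqP lt_ts) (eqP (ltnW lt_ts)); lia.
have := sumE (2 * s + 1); rewrite /antipodal_sum.
by rewrite (_ : 2 * s + 1 - s = s.+1); lia.
Qed.

Lemma sum_column_label n s b : b < 2 * s + 3 ->
  \sum_(i < 4 * n + 2) row_label n s b i = (2 * n + 1) * antipodal_sum n s.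
Proof.
move=> lt_b; rewrite -(big_mkord xpredT (row_label n s b)).
rewrite (_ : 4 * n + 2 = (2 * n + 1) + (2 * n + 1)); last by lia.
rewrite (@big_cat_nat _ _ _ (2 * n + 1)) ?leq_addr //=.
rewrite -{2}[2 * n + 1]add0n big_addn addnK -big_split /=.
rewrite (eq_bigr (fun=> antipodal_sum n s)) => [|i _].
  by rewrite sum_nat_const_nat subn0.
exact: row_label_antipodal.
Qed.

(* The colour of the cycle vertex [i.+1], not [i], modulo [4n+2]. *)
Definition row_weight (n s i : nat) : nat :=
  (row_label n s 1 i.+1 + row_label n s 0 i.+2) +
  (row_label n s 1 i + row_label n s 0 i) +
  (\sum_(j < 2 * s + 1) row_label n s (j + 2) i.+1 + s.+1 * antipodal_sum n s).

(** Let h be [2 * n + 1]. For even [i], the two edges, two cycle vertices and first column give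
    [5T/2 - 3h/2] by [offset_balance], as [n + 1/2 = h/2]; the [s] column pairs, at the odd [i.+1],
    give [s * (T - h)]. The total deviation is [- half_count n s / 2]. For odd [i] the signs are
    reversed. *)
Lemma row_weightE n s i :
  2 * row_weight n s i + (if odd i then 0 else half_count n s) =
  (4 * s + 7) * antipodal_sum n s + (if odd i then half_count n s else 0).
Proof.
have lt0 : 0 < 2 * s + 3 by lia.
have lt1 : 1 < 2 * s + 3 by lia.
have lt2 : 2 < 2 * s + 3 by lia.
have bal := offset_balance n i.
have := row_depth_lt n i lt0; have := row_depth_lt n i.+2 lt0.
have := row_depth_lt n i lt1; have := row_depth_lt n i.+1 lt1.
have := row_depth_lt n i.+1 lt2.
rewrite /row_weight sum_row_label /row_label.
rewrite (_ : odd (i.+1 + 1) = odd i); last by lia.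
rewrite (_ : odd (i.+2 + 0) = odd i); last by lia.
rewrite (_ : odd (i + 1) = ~~ odd i); last by lia.
rewrite (_ : odd (i + 0) = odd i); last by lia.
rewrite (_ : odd (i.+1 + 2) = ~~ odd i); last by lia.
rewrite /= /antipodal_sum.
have NE : half_count n s = 2 * (s * (2 * n + 1)) + 3 * (2 * n + 1).
  by rewrite /half_count; lia.
have le_sT : s * (2 * n + 1) <= s * (2 * half_count n s + 2 * s + 1).
  by rewrite leq_mul2l; lia.
by case: odd; rewrite /= ?mulnBr; lia.
Qed.

(** * Elements and colours of the join *)

Section JoinWithNull.

Variables k m : nat.

Let G := graph_join (cycle_graph k) (null_graph m).

(** A cycle edge is indexed by the end whose successor is the other end; this end is unique once
    [2 < k]. *)
Definition join_index : finType := (('I_k + 'I_m) + ('I_k + 'I_k * 'I_m))%type.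

Definition join_element (x : join_index) : G + {set G} :=
  match x with
  | inl v => inl v
  | inr (inl i) => inr [set inl i; inl (ordS i)]
  | inr (inr p) => inr [set inl p.1; inr p.2]
  end.

Lemma set2_eq (T : finType) (a b c d : T) : [set a; b] = [set c; d] ->
  (a = c /\ b = d) \/ (a = d /\ b = c).
Proof.
move=> eq_ab; have := set21 a b; have := set22 a b; rewrite eq_ab !inE.
move=> /orP[] /eqP bE /orP[] /eqP aE; subst a b; try by [left | right].
- by have := set22 c d; rewrite -eq_ab !inE orbb => /eqP ->; left.
- by have := set21 c d; rewrite -eq_ab !inE orbb => /eqP ->; left.
Qed.

Lemma join_element_inj : 2 < k -> injective join_element.
Proof.
move=> k_gt2 [v|[i|[i j]]] [w|[i'|[i' j']]] //=.
- by case=> ->.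
- case=> /set2_eq[] [] [] eq_i [] eq_Si; first by rewrite eq_i.
  by have := neq_ordSS i' k_gt2; rewrite -eq_i eq_Si eqxx.
- by case=> /set2_eq[] [].
- by case=> /set2_eq[] [].
- by case=> /set2_eq[] [] // [->] [->].
Qed.

Lemma join_element_image : 2 < k -> join_element @: setT = elements G.
Proof.
move=> k_gt2; have k_gt1 := ltnW k_gt2.
have adjS (i : 'I_k) : cycle_adj i (ordS i).
  by rewrite /cycle_adj eqxx andbT neq_ordS.
apply/setP => z; apply/imsetP/idP => [[x _ ->] | ].
  rewrite inE; case: x => [//|[i|[i j]]] /=.
    by apply/imsetP; exists (inl i, inl (ordS i)); rewrite ?inE /= ?adjS.
  by apply/imsetP; exists (inl i, inr j); rewrite ?inE.
case: z => [v _ | e]; first by exists (inl v); rewrite ?in_setT.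
rewrite inE => /imsetP[[[i|j] [i'|j']]]; rewrite inE //=.
- case/andP=> _ /orP[] /eqP -> ->; first by exists (inr (inl i)); rewrite ?in_setT.
  by exists (inr (inl i')); rewrite ?in_setT //= setUC.
- by move=> _ ->; exists (inr (inr (i, j'))); rewrite ?in_setT.
- by move=> _ ->; exists (inr (inr (i', j))); rewrite ?in_setT //= setUC.
Qed.

Lemma tn_color_cycle_vertex (f : G + {set G} -> nat) (i : 'I_k) : 2 < k ->
  tn_color f (inl i) =
    f (join_element (inr (inl i))) + f (inl (inl (ordS i))) +
    (f (join_element (inr (inl (ord_pred i)))) + f (inl (inl (ord_pred i)))) +
    \sum_(j < m) (f (join_element (inr (inr (i, j)))) + f (inl (inr j))).
Proof.
move=> k_gt2; rewrite /tn_color big_sumType /=; congr (_ + _).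
rewrite (sum_cycle_adj i (fun j => f (inr [set inl i; inl j]) + f (inl (inl j)))) //.
by rewrite ord_predK [[set inl (ord_pred i); _]]setUC.
Qed.

Lemma tn_color_null_vertex (f : G + {set G} -> nat) (j : 'I_m) :
  tn_color f (inr j) =
    \sum_(i < k) (f (join_element (inr (inr (i, j)))) + f (inl (inl i))).
Proof.
rewrite /tn_color big_sumType /= [X in _ + X]big_pred0 // addn0.
by apply: eq_bigr => i _; rewrite setUC.
Qed.

End JoinWithNull.

(** * The labeling of the join *)

Definition join_label (n s : nat) (x : join_index (4 * n + 2) (2 * s + 1)) : nat :=
  match x with
  | inl (inl i) => row_label n s 0 i
  | inl (inr j) => null_label n s j
  | inr (inl i) => row_label n s 1 i
  | inr (inr p) => row_label n s (p.2 + 2) p.1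
  end.

Lemma null_label_cases n s j : j < 2 * s + 1 ->
  1 <= null_label n s j <= s \/
  s + 2 * half_count n s < null_label n s j <= antipodal_sum n s.
Proof.
move=> lt_j; rewrite /null_label /antipodal_sum.
by case: (leqP s j) => [le_sj | lt_js]; [right | left]; lia.
Qed.

Lemma null_label_inj n s i j :
  null_label n s i = null_label n s j -> i = j.
Proof. by rewrite /null_label; case: (leqP s i); case: (leqP s j); lia. Qed.

Lemma join_label_inj n s : injective (@join_label n s).
Proof.
have row_null b i j : b < 2 * s + 3 -> j < 2 * s + 1 ->
    row_label n s b i <> null_label n s j.
  by move=> /(row_label_bound n i) ? /(null_label_cases n); lia.
have lt_col (j : 'I_(2 * s + 1)) : j + 2 < 2 * s + 3 by have := ltn_ord j; lia.
have lt0 : 0 < 2 * s + 3 by lia.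
have lt1 : 1 < 2 * s + 3 by lia.
move=> [[i|j]|[i|[i j]]] [[i'|j']|[i'|[i' j']]] /= eq_lab;
  try (by case: (row_null _ _ _ _ _ eq_lab) => //; exact: ltn_ord);
  try (by case: (row_null _ _ _ _ _ (esym eq_lab)) => //; exact: ltn_ord);
  try (by have [] := row_label_inj _ _ _ _ eq_lab; rewrite ?ltn_ord //; lia).
- by have [//|//||| _ /val_inj ->] := row_label_inj _ _ _ _ eq_lab; rewrite ?ltn_ord.
- by have /val_inj -> := null_label_inj eq_lab.
- by have [//|//||| _ /val_inj ->] := row_label_inj _ _ _ _ eq_lab; rewrite ?ltn_ord.
- have [|||| /addIn /val_inj -> /val_inj ->] // := row_label_inj _ _ _ _ eq_lab;
    by rewrite ?ltn_ord.
Qed.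

Lemma join_label_bound n s (x : join_index (4 * n + 2) (2 * s + 1)) :
  1 <= join_label x <= #|join_index (4 * n + 2) (2 * s + 1)|.
Proof.
have -> : #|join_index (4 * n + 2) (2 * s + 1)| = antipodal_sum n s.
  rewrite !(card_sum, card_prod, card_ord) /antipodal_sum /half_count; lia.
have row b i : b < 2 * s + 3 -> 1 <= row_label n s b i <= antipodal_sum n s.
  by move=> /(row_label_bound n i); rewrite /antipodal_sum; lia.
case: x => [[i|j]|[i|[i j]]] /=; try (by apply: row; try have := ltn_ord j; lia).
have := null_label_cases n (ltn_ord j); rewrite /antipodal_sum; lia.
Qed.

Lemma tn_color_join_cycle n s (i : 'I_(4 * n + 2))
    (f : graph_join (cycle_graph (4 * n + 2)) (null_graph (2 * s + 1)) +
         {set graph_join (cycle_graph (4 * n + 2)) (null_graph (2 * s + 1))} -> nat) :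
    1 <= n -> (forall x, f (join_element x) = join_label x) ->
  2 * tn_color f (inl i) + (if odd i then half_count n s else 0) =
  (4 * s + 7) * antipodal_sum n s + (if odd i then 0 else half_count n s).
Proof.
move=> n_gt0 fE; rewrite tn_color_cycle_vertex; last by lia.
have fu j : f (inl (inl j)) = row_label n s 0 j by have := fE (inl (inl j)).
have fv j : f (inl (inr j)) = null_label n s j by have := fE (inl (inr j)).
(* [x] is [i - 1] modulo the period, which is added first to avoid truncation at [i = 0]. *)
have lt_i := ltn_ord i; pose x := (i + (4 * n + 2)).-1.
have modS : i = x.+1 %[mod 4 * n + 2] by rewrite /x prednK ?modnDr //; lia.
rewrite !fE !fu big_split /= (eq_bigr _ (fun j _ => fv j)) sum_null_label.
have := row_weightE n s x; rewrite /row_weight.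
rewrite (_ : odd x = ~~ odd i) ?if_neg; last by rewrite /x; lia.
move=> <-; congr (2 * (_ + _ + (_ + _) + _) + _).
- exact: row_label_congr.
- by apply: row_label_congr; rewrite modn_mod -addn1 -modnDml modS modnDml addn1.
- by apply: row_label_congr; rewrite modn_mod.
- by apply: row_label_congr; rewrite modn_mod.
- congr (_ + _); apply: eq_bigr => j _ /=.
  rewrite (fE (inr (inr (i, j)))); exact: row_label_congr.
Qed.

Lemma tn_color_join_null n s (j : 'I_(2 * s + 1))
    (f : graph_join (cycle_graph (4 * n + 2)) (null_graph (2 * s + 1)) +
         {set graph_join (cycle_graph (4 * n + 2)) (null_graph (2 * s + 1))} -> nat) :
    (forall x, f (join_element x) = join_label x) ->
  tn_color f (inr j) = 2 * (2 * n + 1) * antipodal_sum n s.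
Proof.
move=> fE; have fu i : f (inl (inl i)) = row_label n s 0 i.
  by have := fE (inl (inl i)).
rewrite tn_color_null_vertex.
rewrite (eq_bigr (fun i : 'I__ => row_label n s (j + 2) i + row_label n s 0 i))
  => [|i _]; last by rewrite fE fu.
rewrite big_split /= !sum_column_label; try lia.
by have := ltn_ord j; lia.
Qed.

(** * Properness and the number of colours *)

Lemma odd_ordS (k : nat) (i : 'I_k) : ~~ odd k -> odd (ordS i) = ~~ odd i.
Proof.
move=> even_k; have lt_ik := ltn_ord i.
have [e|ne] := eqVneq i.+1 (k : nat); first by rewrite /= e modnn; lia.
by rewrite /= modn_small //; lia.
Qed.

Theorem theorem2p3 (n s : nat) (hn : 1 <= n) (hs : 1 <= s) :
  is_chi_ltna (graph_join (cycle_graph (4 * n + 2)) (null_graph (2 * s + 1))) 3.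
Proof.
have k_gt2 : 2 < 4 * n + 2 by lia.
have k_gt1 : 1 < 4 * n + 2 by lia.
have k_gt0 : 0 < 4 * n + 2 by lia.
have m_gt0 : 0 < 2 * s + 1 by lia.
pose u0 := Ordinal k_gt0; pose u1 := Ordinal k_gt1; pose v0 := Ordinal m_gt0.
have u01 : cycle_adj u0 u1 by rewrite /cycle_adj -!val_eqE /= modn_small.
have lower (f : graph_join _ _ + _ -> nat) := @triangle_leq_c_tn
  (graph_join (cycle_graph (4 * n + 2)) (null_graph (2 * s + 1)))
  f (inl u0) (inl u1) (inr v0).
split; last by move=> f lab_f; apply: lower.
  by case=> [i|j]; [exists (inr v0) | exists (inl u0)].
have [f [total_f fE]] := total_labeling_transport
  (@join_element_inj _ (2 * s + 1) k_gt2) (@join_element_image _ _ k_gt2)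
  (@join_label_inj n s) (@join_label_bound n s).
have cyc i := tn_color_join_cycle i hn fE.
have nul j := tn_color_join_null j fE.
have N_gt0 : 0 < half_count n s by rewrite /half_count; lia.
have ltNT : half_count n s < antipodal_sum n s by rewrite /antipodal_sum; lia.
(* By [cyc], twice the difference of the colours differs from an odd multiple of
   [antipodal_sum n s] by [half_count n s], hence is not 0. *)
have cyc_neq_nul i j : tn_color f (inl i) <> tn_color f (inr j).
  have := cyc i; rewrite nul => + eq_col; rewrite eq_col.
  have [lt|lt] : 4 * (2 * n + 1) < 4 * s + 7 \/ 4 * s + 7 < 4 * (2 * n + 1) by lia.
    by case: odd; nia.
  by case: odd; nia.
have lab_f : ltna_labeling f.
  split=> // -[i|j] [i'|j'] //=; last by move=> _ /esym; apply: cyc_neq_nul.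
  have even_k : ~~ odd (4 * n + 2) by lia.
  (* Neighbours on the cycle have opposite parity, so by [cyc] their colours would differ by
     [half_count n s]. *)
  case/andP=> _ adj_ii' eq_col; have := cyc i; have := cyc i'; rewrite eq_col.
  by case/orP: adj_ii' => /eqP ->; rewrite odd_ordS //; case: odd => /=; lia.
exists f; split=> //; apply/eqP; rewrite eqn_leq lower // andbT.
(* Positions 0 and 1 carry the colours of all even and all odd positions. *)
apply: (@uniq_leq_size _ _
  [:: tn_color f (inl u0); tn_color f (inl u1); tn_color f (inr v0)]).
  exact: undup_uniq.
move=> c; rewrite mem_undup => /imageP[[i|j] _ ->]; rewrite !inE; last first.
  by rewrite !nul eqxx !orbT.
have := cyc i; have := cyc u0; have := cyc u1 => /=.
by case: (odd i) => c1 c0 ci; apply/or3P; [apply: Or32 | apply: Or31]; apply/eqP; lia.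
Qed.
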